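(* Let $\Pi\subset\mathbb R^d$ be a $d$-dimensional convex polytope that is a semisimplex, i.e. $\Pi$ is affinely isomorphic (equivalently, isomorphic as a barycentric algebra) to a direct product $\Delta_1\times\dots\times\Delta_k$ of simplices. Let $V$ be the vertex set of $\Pi$. Then for every point $\mathbf x\in\Pi$ and every vertex $\mathbf v\in V$, the Wachspress coordinate of $\mathbf x$ with respect to $\mathbf v$ equals the Gibbs coordinate of $\mathbf x$ with respect to $\mathbf v$.
   Context: A $d$-dimensional polytope is simple if each vertex is incident to exactly $d$ edges (a direct product of simplices is simple). Wachspress coordinates on a simple $d$-polytope $\Pi$ with vertices $\mathbf v_1,\dots,\mathbf v_n$: for an interior point $\mathbf x$ and a vertex $\mathbf v_i$, let $\mathbf n_{i_1},\dots,\mathbf n_{i_d}$ be the outward unit normals of the $d$ facets incident with $\mathbf v_i$, ordered according to the orientation of $\Pi$ (so that the determinant below is positive), and set $$w_i(\mathbf x)=\frac{d!\,\det[\mathbf n_{i_1},\dots,\mathbf n_{i_d}]}{\langle \mathbf v_i-\mathbf x,\mathbf n_{i_1}\rangle\cdots\langle \mathbf v_i-\mathbf x,\mathbf n_{i_d}\rangle}.$$ The Wachspress coordinates of $\mathbf x$ are $w(\mathbf x,\mathbf v_i)=w_i(\mathbf x)/\sum_{j=1}^n w_j(\mathbf x)$; they are extended to the boundary of $\Pi$ by continuity. Gibbs coordinates: for $\mathbf x\in\Pi$, among all probability distributions $(p_{\mathbf v})_{\mathbf v\in V}$ on $V$ with $\sum_{\mathbf v\in V}p_{\mathbf v}\mathbf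 v=\mathbf x$, there is a unique one maximizing the entropy $-\sum_{\mathbf v}p_{\mathbf v}\log p_{\mathbf v}$ (with $0\log 0=0$); its values are the Gibbs coordinates of $\mathbf x$ with respect to the vertices $\mathbf v\in V$ (taking the inclusion of the vertex set into $\Pi$ as the valuation function). *)

(* Defs.v *)
From HB Require Import structures.
From mathcomp Require Import all_boot all_order all_algebra.
From mathcomp Require Import all_classical all_reals all_analysis.
Set Implicit Arguments. Unset Strict Implicit. Unset Printing Implicit Defensive.
Import Order.TTheory GRing.Theory Num.Theory.
Import numFieldNormedType.Exports.
Local Open Scope classical_set_scope.
Local Open Scope ring_scope.

Section Defs.
Variables (R : realType) (d : nat).
Notation vec := 'rV[R]_d.

Definition dot (u w : vec) : R := \sum_(i < d) u 0 i * w 0 i.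

(* Product of simplices in "corner" form: the coordinates of R^d are split
   into k groups by g : 'I_d -> 'I_k; group j carries the standard
   #|g^-1(j)|-dimensional simplex {y >= 0, sum y <= 1}.  This set is the
   product Delta_1 x ... x Delta_k (up to affine isomorphism). *)
Definition corner_prod (k : nat) (g : 'I_d -> 'I_k) : set vec :=
  [set y | (forall i, 0 <= y 0 i) /\
           (forall j : 'I_k, \sum_(i < d | g i == j) y 0 i <= 1)].

Definition semisimplex (P : set vec) : Prop :=
  exists (k : nat) (g : 'I_d -> 'I_k) (M : 'M[R]_d) (b : vec),
    M \in unitmx /\ P = [set y *m M + b | y in corner_prod g].

Definition extreme_point (P : set vec) (v : vec) : Prop :=
  P v /\ forall (a c : vec) (t : R), P a -> P c -> 0 < t < 1 ->
    v = t *: a + (1 - t) *: c -> a = v /\ c = v.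

Definition exposed_face (P : set vec) (n : vec) : set vec :=
  [set x | P x /\ forall y, P y -> dot n y <= dot n x].

(* n is the outward unit normal of a facet of the (full-dimensional)
   polytope P: n is a unit vector and the face exposed by n contains d
   affinely independent points (i.e. it has dimension d - 1). *)
Definition facet_normal (P : set vec) (n : vec) : Prop :=
  dot n n = 1 /\
  exists Pts : 'M[R]_d, (forall i, exposed_face P n (row i Pts)) /\
    \rank (row_mx Pts (const_mx 1 : 'M[R]_(d, 1))) = d.

Definition incident_normal (P : set vec) (v n : vec) : Prop :=
  facet_normal P n /\ exposed_face P n v.

(* the rows of N enumerate (without repetition) the outward unit normals of
   the facets incident with v (for a simple polytope there are exactly d) *)
Definition enum_incident (P : set vec) (v : vec) (N : 'M[R]_d) : Prop :=
  (forall j, incident_normal P v (row j N)) /\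
  (forall n, incident_normal P v n -> exists j, n = row j N) /\
  injective (fun j => row j N).

(* w_v(x) = d! det[n_1..n_d] / prod_j <v - x, n_j>, the normals ordered so
   that the determinant is positive, i.e. the determinant is |det N|. *)
Definition wach_weight (P : set vec) (v x : vec) : R :=
  let N := xget 0 [set N | enum_incident P v N] in
  (d`!)%:R * `|\det N| / \prod_(j < d) dot (v - x) (row j N).

Definition wachspress (P : set vec) (V : seq vec) (x v : vec) : R :=
  wach_weight P v x / \sum_(u <- V) wach_weight P u x.

Definition xlnx (t : R) : R := if t == 0 then 0 else t * ln t.

Definition feasible (V : seq vec) (x : vec) (p : 'rV[R]_(size V)) : Prop :=
  (forall i, 0 <= p 0 i) /\ \sum_i p 0 i = 1 /\
  \sum_i p 0 i *: nth 0 V i = x.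

Definition entropy (n : nat) (p : 'rV[R]_n) : R := - \sum_i xlnx (p 0 i).

Arguments feasible V x p : clear implicits.
Definition max_entropy (V : seq vec) (x : vec) (p : 'rV[R]_(size V)) : Prop :=
  feasible V x p /\ forall q, feasible V x q -> entropy q <= entropy p.

(* Gibbs coordinate of x w.r.t. the i-th vertex: the i-th value of the
   (unique) entropy-maximising distribution *)
Arguments max_entropy V x p : clear implicits.
Definition gibbs (V : seq vec) (x : vec) (i : 'I_(size V)) : R :=
  (xget 0 [set p | max_entropy V x p]) 0 i.

End Defs.
Arguments feasible {R d} V x p.
Arguments max_entropy {R d} V x p.
Arguments gibbs {R d} V x i.
Arguments wachspress {R d} P V x v.

(* Main.v *)
Require Import Defs.
From HB Require Import structures.
From mathcomp Require Import all_boot all_order all_algebra all_fingroup.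
From mathcomp Require Import all_classical all_reals all_analysis.
From mathcomp Require Import ring lra.
Set Implicit Arguments. Unset Strict Implicit. Unset Printing Implicit Defensive.
Import Order.TTheory GRing.Theory Num.Theory.
Import numFieldNormedType.Exports.
Local Open Scope classical_set_scope.
Local Open Scope ring_scope.

(* In the barycentric coordinates of the simplex factors, a vertex of the
   product is the choice of one vertex per factor.  The facets through it are
   given by all the barycentric coordinates except the chosen ones, and up to a
   common constant the Wachspress weight is the reciprocal of the product of
   these coordinates: the lengths of the facet gradients cancel between the
   determinant and the denominator, and the remaining determinant has absolute
   value [1 / |det M|] at every vertex.  Multiplying by the product of all the
   coordinates and normalising, the Wachspress coordinate is the product of the
   chosen barycentric coordinates.  This product distribution is also the unique
   entropy maximiser, because every feasible distribution has the barycentric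
   coordinates as marginals and the logarithm of the product distribution is an
   affine function of the vertex, so Gibbs' inequality applies. *)

(** * Dot product of row vectors *)

Section Dot.
Variables (R : realType) (d : nat).
Implicit Types u v w : 'rV[R]_d.

Lemma dotE u v : dot u v = (u *m v^T) 0 0.
Proof. by rewrite mxE; apply: eq_bigr => i _; rewrite mxE. Qed.

Lemma dotC u v : dot u v = dot v u.
Proof. by apply: eq_bigr => i _; rewrite mulrC. Qed.

Lemma dotBl u v w : dot (u - v) w = dot u w - dot v w.
Proof. by rewrite !dotE mulmxBl !mxE. Qed.

Lemma dotBr u v w : dot u (v - w) = dot u v - dot u w.
Proof. by rewrite !(dotC u) dotBl. Qed.

Lemma dotZl a u v : dot (a *: u) v = a * dot u v.
Proof. by rewrite !dotE -scalemxAl mxE. Qed.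

Lemma dotZr a u v : dot u (a *: v) = a * dot u v.
Proof. by rewrite dotC dotZl dotC. Qed.

Lemma dot_gt0 u : u != 0 -> 0 < dot u u.
Proof.
move=> u0; rewrite lt_neqAle; apply/andP; split; last first.
  by apply: sumr_ge0 => i _; rewrite -expr2 sqr_ge0.
apply: contra u0 => /eqP /esym u0; apply/eqP/rowP => i; rewrite mxE.
have /eqP := u0; rewrite psumr_eq0; last by move=> j _; rewrite -expr2 sqr_ge0.
by move=> /allP /(_ i (mem_index_enum _)) /=; rewrite mulf_eq0 orbb => /eqP.
Qed.

End Dot.

(** * Facet normals and the Wachspress weight at a simple vertex *)

(** Two distinct coordinates vanishing on all the points would be two independent linear relations
    on the [d + 1] columns of the homogenised points, leaving rank at most [d - 1]. Hence a facet
    lies in at most one coordinate hyperplane of a chart. *)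
Lemma rank_affine_zero_cols (F : fieldType) (d : nat) (Pts H : 'M[F]_d)
    (v : 'rV[F]_d) (l1 l2 : 'I_d) :
  H \in unitmx ->
  \rank (row_mx Pts (const_mx 1 : 'M[F]_(d, 1))) = d ->
  (forall r, ((row r Pts - v) *m H) 0 l1 = 0) ->
  (forall r, ((row r Pts - v) *m H) 0 l2 = 0) -> l1 = l2.
Proof.
move=> Hu rk z1 z2; apply/eqP; apply: contraT => l12.
pose f (r : 'I_2) := if r == 0 then l1 else l2.
pose Sel : 'M[F]_(d, 2) := \matrix_(l, r) (l == f r)%:R.
have SelE m (A : 'M[F]_(m, d)) i r : (A *m Sel) i r = A i (f r).
  rewrite mxE (bigD1 (f r)) //= big1 ?addr0 => [|j jr]; rewrite mxE.
    by rewrite eqxx mulr1.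
  by rewrite (negPf jr) mulr0.
(* [col_mx H (- v *m H)] is the affine map [x |-> (x - v) H] acting on homogeneous rows [(x, 1)];
   [Sel] keeps its columns [l1] and [l2]. *)
have K0 : row_mx Pts (const_mx 1 : 'M[F]_(d, 1)) *m
    (col_mx H (- v *m H) *m Sel) = 0.
  rewrite mulmxA mul_row_col; apply/matrixP => i r; rewrite SelE [RHS]mxE.
  have -> : Pts *m H + const_mx 1 *m (- v *m H) =
            \matrix_i ((row i Pts - v) *m H).
    apply/row_matrixP => j; rewrite rowK linearD /= !row_mul mulmxBl mulNmx.
    by rewrite row_const [const_mx 1]mx11_scalar mxE mul1mx.
  by rewrite mxE /f; case: (r == 0).
have := mulmx0_rank_max K0; rewrite rk leq_add2l mul_col_mx.
have Sel2 : \rank Sel = 2%N.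
  apply/eqP; change (row_full Sel); apply/row_fullP.
  exists Sel^T; apply/matrixP => r s; rewrite SelE !mxE.
  suff -> : (f s == f r) = (r == s) by [].
  have l21 : l2 == l1 = false by rewrite eq_sym (negPf l12).
  by rewrite /f; case: r => [[|[|//]] ?]; case: s => [[|[|//]] ?] /=;
    rewrite ?eqxx ?l21 ?(negPf l12).
suff : (2 <= \rank (col_mx (H *m Sel) (- v *m H *m Sel)))%N.
  by move=> a b; have := leq_trans a b.
apply: (@leq_trans (\rank (H *m Sel))).
  have := mxrankM_maxr (invmx H) (H *m Sel).
  by rewrite mulKmx // Sel2.
by rewrite -addsmxE mxrankS // addsmxSl.
Qed.

(* [v] is a simple vertex of [P]: in the affine coordinates [z = (x - v) H]
   the set [P] lies in the nonnegative orthant and contains the unit points of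
   the axes, so that the facets at [v] are the coordinate hyperplanes. *)
Section SimpleVertex.
Variables (R : realType) (d : nat) (P : set 'rV[R]_d) (v : 'rV[R]_d).
Variable H : 'M[R]_d.
Hypothesis Hu : H \in unitmx.
Hypothesis Pv : P v.
Hypothesis P_ge0 : forall x l, P x -> 0 <= ((x - v) *m H) 0 l.
Hypothesis P_edge : forall l, P (v + row l (invmx H)).

Let h l : 'rV[R]_d := (col l H)^T.
Let nu l : R := (Num.sqrt (dot (h l) (h l)))^-1.

(** The column [h l] is the gradient of the [l]-th chart coordinate, which is nonnegative on [P];
    the sign makes the normal point outward. *)
Definition vertex_normal l : 'rV[R]_d := - nu l *: h l.

Let dot_h l x : dot (h l) x = (x *m H) 0 l.
Proof. by rewrite dotC mxE; apply: eq_bigr => i _; rewrite !mxE. Qed.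

Let z_edge l s : ((v + row l (invmx H) - v) *m H) 0 s = (l == s)%:R.
Proof. by rewrite addrC addrA addNr add0r -row_mul mulVmx // !mxE. Qed.

Let nu_gt0 l : 0 < nu l.
Proof.
rewrite invr_gt0 sqrtr_gt0 dot_gt0 //; apply: contraT; rewrite negbK => /eqP h0.
have := z_edge l l; rewrite -dot_h h0 eqxx => /eqP.
by rewrite dotE mul0mx mxE eq_sym oner_eq0.
Qed.

Let nu_sqr l : nu l ^+ 2 * dot (h l) (h l) = 1.
Proof.
have h0 : 0 < dot (h l) (h l) by rewrite -sqrtr_gt0 -invr_gt0 nu_gt0.
by rewrite /nu exprVn sqr_sqrtr ?mulVf ?gt_eqF // ltW.
Qed.

Lemma dot_vertex_normal l x :
  dot (v - x) (vertex_normal l) = nu l * ((x - v) *m H) 0 l.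
Proof.
by rewrite /vertex_normal dotZr mulNr -mulrN -dot_h dotC !dotBr opprB.
Qed.

Let exposed_vertex_normal l x : P x -> ((x - v) *m H) 0 l = 0 ->
  exposed_face P (vertex_normal l) x.
Proof.
move=> Px zx; split=> // y Py; rewrite !(dotC (vertex_normal l)).
have := dot_vertex_normal l x; have := dot_vertex_normal l y.
rewrite zx mulr0 !dotBl => e1 e2.
by have := mulr_ge0 (ltW (nu_gt0 l)) (P_ge0 l Py); rewrite -e1; lra.
Qed.

Lemma incident_vertex_normal l : incident_normal P v (vertex_normal l).
Proof.
split; last first.
  by apply: exposed_vertex_normal => //; rewrite subrr mul0mx mxE.
split; first by rewrite /vertex_normal dotZl dotZr -(nu_sqr l); ring.
(* The edge endpoint [l] is the only one off the facet, so its row is replaced by [v]. *)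
pose Pts := \matrix_r (if r == l then v else v + row r (invmx H)).
exists Pts; split=> [r|].
  rewrite rowK; apply: exposed_vertex_normal; case: ifPn => rl //.
    by rewrite subrr mul0mx mxE.
  by rewrite z_edge (negPf rl).
apply/eqP; change (row_free (row_mx Pts (const_mx 1 : 'M[R]_(d, 1)))).
(* In a relation [u] among the homogenised points, the chart coordinate [s] isolates [u_s] for
   [s != l]; the column of ones then kills [u_l]. *)
apply: inj_row_free => u; rewrite mul_mx_row -row_mx0 => /eq_row_mx [uP u1].
have su : \sum_i u 0 i = 0.
  move/rowP: u1 => /(_ 0); rewrite !mxE => e; rewrite -[RHS]e.
  by apply: eq_bigr => i _; rewrite mxE mulr1.
have us s : s != l -> u 0 s = 0.
  move=> sl; have /rowP /(_ s) : (u *m Pts - (\sum_i u 0 i) *: v) *m H = 0.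
    by rewrite uP su scale0r subrr mul0mx.
  rewrite [u *m Pts]mulmx_sum_row scaler_suml -sumrB mulmx_suml summxE [RHS]mxE => <-.
  rewrite (bigD1 s) //= big1 ?addr0 => [|r rs].
    by rewrite rowK (negPf sl) -scalerBr -scalemxAl mxE z_edge eqxx mulr1.
  rewrite rowK -scalerBr -scalemxAl mxE; case: ifP => _.
    by rewrite subrr mul0mx mxE mulr0.
  by rewrite z_edge (negPf rs) mulr0.
apply/rowP => s; rewrite mxE; have [->|/us //] := eqVneq s l.
by rewrite -su (bigD1 l) //= big1 ?addr0 // => i /us.
Qed.

(** Expand [n] on the gradients with coefficients [a]. Testing the edge endpoints gives [a <= 0], so
    at a point of the face the terms [z_l a_l] are nonpositive with nonnegative sum, hence all zero.
    Every coordinate with [a_l != 0] therefore vanishes on the facet, the rank lemma leaves exactly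
    one, and unit length fixes its coefficient. *)
Lemma incident_normalE n : incident_normal P v n -> exists l, n = vertex_normal l.
Proof.
move=> [[n1 [Pts [facePts rk]]] [_ maxv]].
have [a nE] : exists a : 'cV_d, n^T = H *m a.
  by exists (invmx H *m n^T); rewrite mulKVmx.
have dotn x : dot n (x - v) = \sum_l ((x - v) *m H) 0 l * a l 0.
  by rewrite dotC dotE nE mulmxA [LHS]mxE.
have a_le0 l : a l 0 <= 0.
  have := maxv _ (P_edge l); rewrite -subr_le0 -dotBr dotn (bigD1 l) //= big1.
    by rewrite z_edge eqxx mul1r addr0.
  by move=> s sl; rewrite z_edge eq_sym (negPf sl) mul0r.
have za r l : ((row r Pts - v) *m H) 0 l * a l 0 = 0.
  have [Pr maxr] := facePts r; have := maxr _ Pv.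
  rewrite -subr_ge0 -dotBr dotn => s_ge0.
  have s_le0 i : ((row r Pts - v) *m H) 0 i * a i 0 <= 0.
    exact: mulr_ge0_le0 (P_ge0 _ Pr) (a_le0 _).
  apply/eqP; rewrite -oppr_eq0.
  have : \sum_i - (((row r Pts - v) *m H) 0 i * a i 0) == 0.
    rewrite eq_le sumrN oppr_le0 s_ge0 oppr_ge0 /=.
    by apply: sumr_le0 => i _; exact: s_le0.
  rewrite psumr_eq0 => [/allP /(_ l (mem_index_enum _)) //|i _].
  by rewrite oppr_ge0 s_le0.
have [l al] : exists l, a l 0 != 0.
  apply/existsP; apply: contraT; rewrite negb_exists => /forallP a0.
  have a0' : a = 0.
    by apply/colP => l; rewrite mxE; apply/eqP; have := a0 l; rewrite negbK.
  move: n1; rewrite dotE nE a0' mulmx0 mulmx0 mxE => /esym/eqP.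
  by rewrite oner_eq0.
have a0 s : s != l -> a s 0 = 0.
  move=> sl; apply/eqP; apply: contraT => as0.
  have zcol t : a t 0 != 0 -> forall r, ((row r Pts - v) *m H) 0 t = 0.
    by move=> at0 r; have /eqP := za r t; rewrite mulf_eq0 (negPf at0) orbF => /eqP.
  by rewrite (rank_affine_zero_cols Hu rk (zcol _ as0) (zcol _ al)) eqxx in sl.
have nh : n = a l 0 *: h l.
  apply: trmx_inj; rewrite nE linearZ /= trmxK; apply/colP => i.
  rewrite !mxE (bigD1 l) //= big1 ?addr0 => [|s sl]; first by rewrite mulrC.
  by rewrite a0 ?mulr0.
exists l; rewrite nh /vertex_normal; congr (_ *: _); apply/eqP.
rewrite eq_sym eqr_oppLR -(eqrXn2 (n := 2)) // ?oppr_ge0 ?(ltW (nu_gt0 l)) //.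
have h0 : dot (h l) (h l) != 0.
  by apply/negP => /eqP h0; have /eqP := nu_sqr l; rewrite h0 mulr0 eq_sym oner_eq0.
by apply/eqP/(mulIf h0); rewrite nu_sqr -n1 nh dotZl dotZr sqrrN; ring.
Qed.

Let N0 : 'M[R]_d := \matrix_l vertex_normal l.

Let N0E : N0 = diag_mx (\row_l - nu l) *m H^T.
Proof. by apply/matrixP => i j; rewrite mul_diag_mx !mxE. Qed.

Let detN0 : `|\det N0| = (\prod_l nu l) * `|\det H|.
Proof.
rewrite N0E det_mulmx det_diag det_tr normrM normr_prod; congr (_ * _).
by apply: eq_bigr => l _; rewrite mxE normrN gtr0_norm.
Qed.

Let N0_unit : N0 \in unitmx.
Proof.
rewrite unitmxE unitfE -normr_gt0 detN0 mulr_gt0 ?prodr_gt0 //.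
by rewrite normr_gt0 -unitfE -unitmxE.
Qed.

Let enum_incident_N0 : enum_incident P v N0.
Proof.
split; first by move=> l; rewrite rowK; apply: incident_vertex_normal.
split=> [n /incident_normalE [l ->]|]; first by exists l; rewrite rowK.
move=> i j /= /(congr1 (mulmx^~ (invmx N0))); rewrite -!row_mul mulmxV //.
move/rowP/(_ j); rewrite !mxE eqxx; case: eqP => // _ /eqP.
by rewrite eq_sym oner_eq0.
Qed.

(** The enumeration returned by [xget] is unspecified, but it is a row permutation of [N0], which
    changes neither the absolute determinant nor the product. *)
Lemma wach_weight_simple_vertex x :
  wach_weight P v x =
  (d`!)%:R * `|\det H| / \prod_l ((x - v) *m H) 0 l.
Proof.
rewrite /wach_weight; set N := xget _ _.
have [Ninc [_ Ninj]] : enum_incident P v N.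
  by apply: (xgetPex 0 (P := [set N | enum_incident P v N])); exists N0.
have /choice [s sE] : forall j, exists l, row j N = vertex_normal l.
  by move=> j; apply: incident_normalE.
have s_inj : injective s by move=> i j sij; apply: Ninj; rewrite !sE sij.
have NE : N = row_perm (perm s_inj) N0.
  by apply/row_matrixP => j; rewrite sE; apply/rowP => i; rewrite !mxE permE.
have prodE : \prod_j dot (v - x) (row j N) =
    (\prod_l nu l) * \prod_l ((x - v) *m H) 0 l.
  rewrite -big_split /= [RHS](reindex_inj s_inj) /=; apply: eq_bigr => j _.
  by rewrite sE dot_vertex_normal.
rewrite prodE NE row_permE det_mulmx det_perm normrM normr_sign mul1r detN0.
have nu0 : \prod_l nu l != 0 by rewrite gt_eqF ?prodr_gt0.
by rewrite mulrCA -mulf_div divff // mul1r.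
Qed.

End SimpleVertex.

(** * Gibbs' inequality and uniqueness of the entropy maximiser *)

Section Entropy.
Variable R : realType.

Lemma ln_prod (I : Type) (r : seq I) (Q : pred I) (F : I -> R) :
  (forall i, Q i -> 0 < F i) ->
  ln (\prod_(i <- r | Q i) F i) = \sum_(i <- r | Q i) ln (F i).
Proof.
move=> F_gt0; elim: r => [|i r IH]; first by rewrite !big_nil ln1.
rewrite !big_cons; case: ifP => // Qi.
by rewrite lnM ?IH // posrE ?F_gt0 ?prodr_gt0.
Qed.

(** Pointwise form of Gibbs' inequality: [1 + t < exp t] at [t = ln p - ln q], multiplied by [q].
    The equality case is recorded because it yields uniqueness of the maximiser. *)
Lemma gibbs_leif (p q : R) : 0 <= p -> 0 <= q -> (p = 0 -> q = 0) ->
  q - p <= xlnx q - q * ln p ?= iff (q == p).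
Proof.
move=> p0 q0 pq; have [->|q_p] := eqVneq q p.
  rewrite subrr; apply/leifP; rewrite /xlnx.
  by have [->|_] := eqVneq p 0; rewrite ?mul0r subrr.
apply/leifP; rewrite /xlnx; have [qe|qn] := eqVneq q 0.
  by rewrite qe mul0r subrr sub0r oppr_lt0 lt_def p0 andbT -qe eq_sym.
have q_gt0 : 0 < q by rewrite lt_def qn.
have p_gt0 : 0 < p by rewrite lt_def p0 andbT; apply: contraNneq qn => /pq ->.
have t0 : ln p - ln q != 0.
  by rewrite subr_eq0; apply: contraNneq q_p => /ln_inj ->; rewrite ?posrE.
have := expR_gt1Dx t0; rewrite expRD expRN !lnK ?posrE // ltr_pdivlMr //.
by move=> ?; lra.
Qed.

(** [L] extends [ln p] beyond the support of [p]. As its mean is the same under all feasible [q],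
    the cross-entropy of [q] against [p] is always the entropy of [p]. *)
Lemma max_entropy_uniqueP (d : nat) (V : seq 'rV[R]_d) (x : 'rV[R]_d)
    (p : 'rV[R]_(size V)) (L : 'I_(size V) -> R) :
  feasible V x p ->
  (forall i, p 0 i != 0 -> ln (p 0 i) = L i) ->
  (forall q, feasible V x q -> \sum_i q 0 i * L i = \sum_i p 0 i * L i) ->
  (forall q, feasible V x q -> forall i, p 0 i = 0 -> q 0 i = 0) ->
  forall q, max_entropy V x q <-> q = p.
Proof.
move=> fp lnp qL qp.
have leq q : feasible V x q -> entropy q <= entropy p ?= iff (q == p).
  move=> fq; have [q0 [q1 _]] := fq; have [p0 [p1 _]] := fp.
  have entp : entropy p = - \sum_i q 0 i * ln (p 0 i).
    rewrite /entropy; congr (- _).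
    rewrite (eq_bigr (fun i => p 0 i * L i)) => [|i _].
      rewrite -(qL q) //; apply: eq_bigr => i _.
      have [/(qp _ fq) ->|/lnp -> //] := eqVneq (p 0 i) 0.
      by rewrite !mul0r.
    by rewrite /xlnx; case: eqVneq => [->|/lnp ->] //; rewrite mul0r.
  (* Both distributions have mass 1, so the left-hand sides [q - p] sum to 0. *)
  have := leif_sum (fun i (_ : true) => gibbs_leif (p0 i) (q0 i) (qp q fq i)).
  rewrite !sumrB q1 p1 subrr.
  have -> : [forall (i | true), q 0 i == p 0 i] = (q == p).
    apply/forallP/eqP => [e|-> i]; last by rewrite /= eqxx.
    by apply/rowP => i; apply/eqP; apply: e.
  move=> [le0 eq0]; rewrite entp /entropy; split; first by lra.
  by rewrite -eq0 eqr_opp [RHS]eq_sym subr_eq0.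
move=> q; split=> [[fq maxq]|->].
  apply/eqP; rewrite -(leq q fq) eq_le (leq q fq) /=.
  exact: maxq.
by split=> // r /leq [].
Qed.

End Entropy.

(** * Continuity of finite products and sums *)

Lemma continuous_prod (R : realType) (T : topologicalType) (I : Type)
    (r : seq I) (Q : pred I) (F : I -> T -> R) :
  (forall i, Q i -> continuous (F i)) ->
  continuous (fun x => \prod_(i <- r | Q i) F i x).
Proof.
move=> cF x; elim: r => [|i r IH].
  by under eq_fun do rewrite big_nil; rewrite ?big_nil; apply: cvg_cst.
under eq_fun do rewrite big_cons; rewrite ?big_cons.
by case: ifP => // Qi; apply: cvgM => //; apply: cF.
Qed.

Lemma continuous_sum (R : realType) (T : topologicalType) (I : Type)
    (r : seq I) (F : I -> T -> R) :
  (forall i, continuous (F i)) -> continuous (fun x => \sum_(i <- r) F i x).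
Proof.
move=> cF x; elim: r => [|i r IH].
  by under eq_fun do rewrite big_nil; rewrite ?big_nil; apply: cvg_cst.
under eq_fun do rewrite big_cons; rewrite ?big_cons.
by apply: cvgD => //; apply: cF.
Qed.

(** * Barycentric coordinates on a product of simplices *)

Section Semisimplex.
Variables (R : realType) (d k : nat) (g : 'I_d -> 'I_k).
Variables (M : 'M[R]_d) (b : 'rV[R]_d).
Hypothesis Mu : M \in unitmx.
Implicit Types (x v : 'rV[R]_d) (j : 'I_k).

Let P : set 'rV[R]_d := [set y *m M + b | y in corner_prod g].

(* [inl i] is the facet [y_i = 0] and [inr j] the facet on which the
   coordinates of the [j]-th simplex sum to [1]; when the [j]-th simplex is a
   point, [inr j] is a spurious facet with barycentric coordinate 1. *)
Notation facet := ('I_d + 'I_k)%type.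
Implicit Type f : facet.

Definition block f : 'I_k := match f with inl i => g i | inr j => j end.

(** The slacks of the inequalities in one block sum to 1: they are the barycentric coordinates in
    that simplex factor. *)
Definition bary f x : R :=
  let y := (x - b) *m invmx M in
  match f with inl i => y 0 i | inr j => 1 - \sum_(i | g i == j) y 0 i end.

(** Gradient of [bary f] in the corner coordinates [y], before transport by [M]. *)
Definition grad f : 'rV[R]_d :=
  \row_i match f with inl i' => (i == i')%:R | inr j => - (g i == j)%:R end.

Lemma bary_inl y i : bary (inl i) (y *m M + b) = y 0 i.
Proof. by rewrite /bary addrK mulmxK. Qed.

Lemma bary_inr y j : bary (inr j) (y *m M + b) = 1 - \sum_(i | g i == j) y 0 i.
Proof. by rewrite /bary addrK mulmxK. Qed.

Lemma affine_preim x : exists y, x = y *m M + b.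
Proof. by exists ((x - b) *m invmx M); rewrite mulmxKV // subrK. Qed.

Lemma bary_inj x v : (forall f, bary f x = bary f v) -> x = v.
Proof.
have [y ->] := affine_preim x; have [z ->] := affine_preim v.
move=> e; congr (_ *m _ + _); apply/rowP => i.
by have := e (inl i); rewrite !bary_inl.
Qed.

Lemma semisimplexE x : P x <-> forall f, 0 <= bary f x.
Proof.
split=> [[y [y0 y1] <-] [i|j]|].
- by rewrite bary_inl.
- by rewrite bary_inr subr_ge0.
have [y ->] := affine_preim x => x0; exists y => //; split=> [i|j].
  by have := x0 (inl i); rewrite bary_inl.
by have := x0 (inr j); rewrite bary_inr subr_ge0.
Qed.

Lemma baryE f x : bary f x = (x *m (invmx M *m (grad f)^T)) 0 0 + bary f 0.
Proof.
rewrite mulmxA /bary mulmxBl sub0r mulNmx.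
move: (x *m _) (b *m _) => y z.
case: f => [i|j]; rewrite mxE.
  rewrite [in RHS]mxE (bigD1 i) //= big1 => [|l li].
    by rewrite !mxE eqxx mulr1 addr0.
  by rewrite !mxE (negPf li) mulr0.
rewrite [RHS]addrCA; congr (1 + _); rewrite -!sumrN.
rewrite [LHS]big_mkcond [X in _ = _ + X]big_mkcond -big_split /=.
apply: eq_bigr => i _; rewrite !mxE; case: eqP => _; rewrite ?mulr1n ?mulr0n; ring.
Qed.

Lemma baryB f x v :
  bary f x - bary f v = ((x - v) *m (invmx M *m (grad f)^T)) 0 0.
Proof.
rewrite (baryE f x) (baryE f v) opprD addrACA subrr addr0 mulmxBl.
by move: (x *m _) (v *m _) => y z; rewrite !mxE.
Qed.

(** The parameter [t] ranges over all reals because the formula also serves to extrapolate beyond a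
    segment. *)
Lemma bary_comb f (t : R) x v :
  bary f (t *: x + (1 - t) *: v) = t * bary f x + (1 - t) * bary f v.
Proof.
rewrite baryE (baryE f x) (baryE f v) mulmxDl -!scalemxAl.
by move: (x *m _) (v *m _) => y z; rewrite !mxE; ring.
Qed.

Lemma bary_sum f n (p : 'I_n -> R) (v : 'I_n -> 'rV[R]_d) : \sum_i p i = 1 ->
  bary f (\sum_i p i *: v i) = \sum_i p i * bary f (v i).
Proof.
move=> p1; under [RHS]eq_bigr do rewrite baryE mulrDr.
rewrite big_split /= -mulr_suml p1 mul1r baryE; congr (_ + _).
rewrite mulmx_suml summxE; apply: eq_bigr => i _.
by rewrite -scalemxAl mxE.
Qed.

Lemma sum_bary j x : \sum_(f | block f == j) bary f x = 1.
Proof.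
rewrite big_sumType /= [X in _ + X](big_pred1 j) //.
by rewrite addrC subrK.
Qed.

Lemma bary_le1 f x : P x -> bary f x <= 1.
Proof.
move=> /semisimplexE x0; rewrite -(sum_bary (block f) x) (bigD1 f) //=.
by rewrite lerDl sumr_ge0.
Qed.

Lemma continuous_bary f : continuous (bary f).
Proof.
have cxG (G : 'cV[R]_d) : continuous (fun x : 'rV[R]_d => (x *m G) 0 0).
  under eq_fun do rewrite mxE.
  apply: continuous_sum => i x.
  apply: continuousM; [exact: coord_continuous | exact: cst_continuous].
have -> : bary f = fun x => (x *m (invmx M *m (grad f)^T)) 0 0 + bary f 0.
  by apply/funext => x; exact: baryE.
by move=> x; apply: (@cvgD R R _ (nbhs x)); [apply: cxG | apply: cvg_cst].
Qed.

(** * Vertices, their facets and their neighbours *)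

(* A vertex is encoded by the choice of a vertex of every simplex, namely of
   the facet opposite to it. *)
Definition choices := family (fun j => [pred f | block f == j]).
Implicit Type c : {ffun 'I_k -> facet}.

Lemma choicesP c : reflect (forall j, block (c j) = j) (c \in choices).
Proof.
apply: (iffP familyP) => h j; first by apply/eqP; have := h j; rewrite inE.
by rewrite inE h.
Qed.

(** Since the choice names the opposite facet, [inl i] selects the unit point of axis [i] in its
    block and [inr j] the origin of block [j]. *)
Definition vertex c : 'rV[R]_d := (\row_i (c (g i) == inl i)%:R) *m M + b.

Lemma bary_vertex c f : c \in choices -> bary f (vertex c) = (c (block f) == f)%:R.
Proof.
move=> /choicesP cB; case: f => [i|j]; first by rewrite bary_inl mxE.
rewrite bary_inr /=; case ecj : (c j) => [i|j'] /=.
  have gi : g i = j by have := cB j; rewrite ecj.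
  rewrite (bigD1 i) ?gi //= mxE gi ecj eqxx big1 ?addr0 ?subrr // => l /andP [/eqP gl li].
  by rewrite mxE gl ecj; case: eqP => // -[] il; rewrite il eqxx in li.
have jj : j' = j by have := cB j; rewrite ecj.
rewrite jj eqxx big1 ?subr0 // => l /eqP gl; rewrite mxE gl ecj.
by case: eqP.
Qed.

Lemma vertex_inj : {in choices &, injective vertex}.
Proof.
move=> c c' cB cB' e; apply/ffunP => j.
have := bary_vertex (c j) cB; rewrite e bary_vertex // (choicesP _ cB) eqxx.
by case: eqP => // _ /eqP; rewrite eq_sym oner_eq0.
Qed.

Lemma semisimplex_vertex c : c \in choices -> P (vertex c).
Proof. by move=> cB; apply/semisimplexE => f; rewrite bary_vertex // ler0n. Qed.

(** Indexes the facets through the vertex, that is the facets not chosen, by ['I_d]: when [inl i] is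
    chosen, its slot goes to the [inr] facet of the same block. *)
Definition vertex_facet c (i : 'I_d) : facet :=
  if c (g i) == inl i then inr (g i) else inl i.

Lemma block_vertex_facet c i : block (vertex_facet c i) = g i.
Proof. by rewrite /vertex_facet; case: ifP. Qed.

Lemma vertex_facet_inj c : injective (vertex_facet c).
Proof.
move=> i l; rewrite /vertex_facet; case: ifP => [/eqP ci|_]; case: ifP => [/eqP cl|_] //.
  by move=> [gil]; rewrite gil cl in ci; case: ci.
by move=> [].
Qed.

Lemma vertex_facet_neq c i : c (g i) != vertex_facet c i.
Proof. by rewrite /vertex_facet; case: ifPn => // /eqP ->. Qed.

Lemma vertex_facet_image c : c \in choices ->
  [set vertex_facet c i | i in [set: 'I_d]%SET]%SET =
  [set f | c (block f) != f]%SET.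
Proof.
move=> /choicesP cB; apply/setP => f; rewrite inE; apply/imsetP/idP => [[i _ ->]|].
  by rewrite block_vertex_facet vertex_facet_neq.
case: f => [i|j] /= cf; first by exists i; [rewrite inE | rewrite /vertex_facet (negPf cf)].
case ecj : (c j) cf => [i|j']; have := cB j; rewrite ecj /= => gi cf.
  by exists i; [rewrite inE | rewrite /vertex_facet gi ecj eqxx].
by rewrite gi eqxx in cf.
Qed.

(** The other end of the edge that leaves the facet [vertex_facet c l]: within block [g l], it is
    opposite to that facet. *)
Definition neighbour c l : {ffun 'I_k -> facet} :=
  [ffun j => if j == g l then vertex_facet c l else c j].

Lemma neighbour_choices c l : c \in choices -> neighbour c l \in choices.
Proof.
move=> /choicesP cB; apply/choicesP => j; rewrite ffunE.
by case: eqP => [->|_]; rewrite ?block_vertex_facet.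
Qed.

Lemma bary_vertex_facet c i : c \in choices -> bary (vertex_facet c i) (vertex c) = 0.
Proof.
by move=> cB; rewrite bary_vertex // block_vertex_facet (negPf (vertex_facet_neq _ _)).
Qed.

Lemma bary_neighbour c i l : c \in choices ->
  bary (vertex_facet c i) (vertex (neighbour c l)) = (i == l)%:R.
Proof.
move=> cB; rewrite bary_vertex ?neighbour_choices // block_vertex_facet ffunE.
have [e|gil] := eqVneq (g i) (g l).
  by rewrite (inj_eq (@vertex_facet_inj c)) eq_sym.
rewrite (negPf (vertex_facet_neq _ _)).
by have [il|//] := eqVneq i l; rewrite il eqxx in gil.
Qed.

Definition vertex_grad c : 'M[R]_d := \matrix_i grad (vertex_facet c i).

(* The columns of the inverse of [vertex_grad c] are the edges at [vertex c];
   they turn out to be the columns of [vertex_grad c] itself. *)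
Lemma vertex_grad_involutive c : c \in choices -> vertex_grad c *m vertex_grad c = 1%:M.
Proof.
move=> cB.
pose E := (\matrix_(m, l) ((neighbour c l (g m) == inl m)%:R - (c (g m) == inl m)%:R) : 'M[R]_d).
have GE : vertex_grad c *m E = 1%:M.
  apply/matrixP => i l; rewrite [RHS]mxE -(bary_neighbour i l cB).
  rewrite -[RHS]subr0 -(bary_vertex_facet i cB) baryB.
  rewrite /vertex opprD addrACA subrr addr0 -mulmxBl -mulmxA mulKVmx //.
  rewrite !mxE; apply: eq_bigr => m _; rewrite !mxE mulrC; congr (_ * _).
suff {2}-> : vertex_grad c = E by [].
apply/matrixP => m l; rewrite !mxE ffunE /vertex_facet.
have [lm|lm] := eqVneq l m.
  by rewrite lm eqxx; case: eqP => _; rewrite ?eqxx ?sub0r ?subr0.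
have X : ((if c (g l) == inl l then inr (g l) else inl l : facet) == inl m) = false.
  by case: ifP => _; case: eqP => // -[] e; rewrite e eqxx in lm.
have [gml|gml] := eqVneq (g m) (g l).
  rewrite X; case: eqP => _; rewrite ?subr0 ?(negPf lm) //.
  by rewrite gml eqxx sub0r.
case: eqP => _; rewrite ?(negPf lm) ?subrr //.
by rewrite eq_sym (negPf gml) oppr0.
Qed.

(** The matrix to be used as [H] at this simple vertex: its coordinates are the barycentric
    coordinates of the facets through the vertex. *)
Definition vertex_chart c : 'M[R]_d := invmx M *m (vertex_grad c)^T.

Lemma vertex_chart_unit c : c \in choices -> vertex_chart c \in unitmx.
Proof.
move=> cB; rewrite unitmx_mul unitmx_inv Mu unitmx_tr.
by case: (mulmx1_unit (vertex_grad_involutive cB)).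
Qed.

(** An involution has determinant 1 or -1. The value is thus the same at all vertices and will
    cancel in the normalisation. *)
Lemma norm_det_vertex_chart c : c \in choices ->
  `|\det (vertex_chart c)| = `|\det M|^-1.
Proof.
move=> cB; rewrite det_mulmx det_inv det_tr normrM normfV.
have /eqP : \det (vertex_grad c) ^+ 2 = 1.
  by rewrite expr2 -det_mulmx vertex_grad_involutive // det1.
by rewrite sqrf_eq1 => /orP [] /eqP ->; rewrite ?normrN normr1 mulr1.
Qed.

Lemma vertex_chartE c i x : c \in choices ->
  ((x - vertex c) *m vertex_chart c) 0 i = bary (vertex_facet c i) x.
Proof.
move=> cB; rewrite -[RHS]subr0 -(bary_vertex_facet i cB) baryB.
rewrite !mulmxA !mxE; apply: eq_bigr => m _.
by rewrite !mxE.
Qed.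

Lemma vertex_edge c l : c \in choices ->
  vertex c + row l (invmx (vertex_chart c)) = vertex (neighbour c l).
Proof.
move=> cB; have Cu := vertex_chart_unit cB.
have E : (vertex (neighbour c l) - vertex c) *m vertex_chart c = row l 1%:M.
  by apply/rowP => i; rewrite vertex_chartE // bary_neighbour // !mxE eq_sym.
by rewrite -[invmx _]mul1mx row_mul -E mulmxK // addrC subrK.
Qed.

(** * The product distribution on the vertices *)

(** Indexed by facets rather than blocks, so that the complementary factors in the product over all
    facets are those of the facets through the vertex. *)
Definition weight c x : R := \prod_(f | c (block f) == f) bary f x.

Lemma prod_vertex_facet c x : c \in choices ->
  (\prod_i bary (vertex_facet c i) x) * weight c x = \prod_f bary f x.
Proof.
move=> cB; rewrite mulrC [RHS](bigID (fun f => c (block f) == f)) /=.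
congr (_ * _).
transitivity (\prod_(f in [set f | c (block f) != f]%SET) bary f x); last first.
  by apply: eq_bigl => f; rewrite inE.
rewrite -vertex_facet_image // big_imset /=; last first.
  by move=> i l _ _; apply: vertex_facet_inj.
by apply: eq_bigl => i; rewrite inE.
Qed.

Lemma weightE c x : c \in choices -> weight c x = \prod_j bary (c j) x.
Proof.
move=> /choicesP cB; rewrite /weight (reindex_onto c block) /=; last by move=> f /eqP.
by apply: eq_bigl => j; rewrite cB !eqxx.
Qed.

(** By distributivity this is the product over the blocks of the sums [sum_bary]. *)
Lemma sum_weight x : \sum_(c in choices) weight c x = 1.
Proof.
rewrite (eq_bigr (fun c => \prod_j bary (c j) x)) => [|c cB]; last exact: weightE.
rewrite -(bigA_distr_big_dep (fun j f => block f == j) (fun _ f => bary f x)).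
by rewrite big1 // => j _; apply: sum_bary.
Qed.

Lemma weight_marginal x f :
  \sum_(c in choices) weight c x * bary f (vertex c) = bary f x.
Proof.
(* The indicator acts only in the block of [f], so after factorisation that block contributes
   [bary f x] and every other block 1. *)
pose F j h : R := bary h x * ((j == block f) ==> (h == f))%:R.
rewrite (eq_bigr (fun c => \prod_j F j (c j))) => [|c cB].
  rewrite -(bigA_distr_big_dep (fun j f => block f == j) F).
  rewrite (bigD1 (block f)) //= [X in _ * X]big1 => [|j jf]; last first.
    rewrite -[RHS](sum_bary j x); apply: eq_bigr => h _.
    by rewrite /F (negPf jf) mulr1.
  rewrite mulr1 (bigD1 f) //= big1 => [|h /andP [_ hf]].
    by rewrite addr0 /F !eqxx mulr1.
  by rewrite /F eqxx (negPf hf) mulr0.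
rewrite weightE // bary_vertex // big_split /=; congr (_ * _).
rewrite (bigD1 (block f)) //= eqxx big1 ?mulr1 // => j jf.
by rewrite (negPf jf).
Qed.

Lemma weight_ge0 c x : P x -> 0 <= weight c x.
Proof. by move=> /semisimplexE x0; apply: prodr_ge0. Qed.

Lemma wach_weight_vertex c x : c \in choices -> (forall f, bary f x != 0) ->
  wach_weight P (vertex c) x =
  (d`!)%:R / `|\det M| / (\prod_f bary f x) * weight c x.
Proof.
move=> cB x0.
rewrite (wach_weight_simple_vertex (H := vertex_chart c)); first last.
- by move=> l; rewrite vertex_edge //; apply/semisimplex_vertex/neighbour_choices.
- by move=> y l /semisimplexE y0; rewrite vertex_chartE.
- exact: semisimplex_vertex.
- exact: vertex_chart_unit.
rewrite norm_det_vertex_chart // -(prod_vertex_facet x cB).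
under eq_bigr do rewrite vertex_chartE //.
have w0 : weight c x != 0 by apply/prodf_neq0.
by rewrite invfM -!mulrA mulVf ?mulr1.
Qed.

(** * Extreme points and interior points *)

(** The chart coordinates are nonnegative on [P] and vanish at the vertex, so they vanish at both
    ends of any segment of [P] with the vertex in its interior. *)
Lemma extreme_vertex c : c \in choices -> extreme_point P (vertex c).
Proof.
move=> cB; split; first exact: semisimplex_vertex.
have main a e (t : R) : P a -> P e -> 0 < t < 1 ->
    vertex c = t *: a + (1 - t) *: e -> a = vertex c.
  move=> /semisimplexE a0 /semisimplexE e0 /andP [t0 t1] E.
  apply/eqP; rewrite -subr_eq0; apply/eqP.
  have Hu := vertex_chart_unit cB.
  rewrite -(mulmxK Hu (a - vertex c)).
  suff -> : (a - vertex c) *m vertex_chart c = 0 by rewrite mul0mx.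
  apply/rowP => i; rewrite vertex_chartE // mxE.
  have := bary_vertex_facet i cB; rewrite E bary_comb => /eqP.
  rewrite paddr_eq0; last 2 first.
  - by rewrite mulr_ge0 // ltW.
  - by rewrite mulr_ge0 // subr_ge0 ltW.
  by rewrite mulf_eq0 gt_eqF //= => /andP [/eqP].
move=> a e t Pa Pe t01 E; split; first exact: (main a e t).
apply: (main e a (1 - t)) => //.
  by case/andP: t01 => t0 t1; rewrite subr_gt0 t1 ltrBlDr ltrDl.
by rewrite E subKr addrC.
Qed.

(** The weights at [v] sum to 1, so some vertex has positive weight. Then [v] can be pushed slightly
    away from that vertex inside [P], and extremality forces the two to coincide. *)
Lemma extreme_pointE v : extreme_point P v -> exists2 c, c \in choices & v = vertex c.
Proof.
move=> [Pv ext].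
have [c cB w0] : exists2 c, c \in choices & weight c v != 0.
  apply/exists_inP; apply: contraT => /exists_inPn w0.
  have := sum_weight v; rewrite big1 => [/esym/eqP|c /w0]; first by rewrite oner_eq0.
  by rewrite negbK => /eqP.
exists c => //.
have v0 f : 0 <= bary f v by move: f; apply/semisimplexE.
have w_gt0 : 0 < weight c v by rewrite lt_def w0 weight_ge0.
have w_le f : c (block f) == f -> weight c v <= bary f v.
  move=> cf; rewrite /weight (bigD1 f) //= ler_piMr //.
  by apply: prodr_ile1 => h _; rewrite v0 bary_le1.
have w_le1 : weight c v <= 1.
  by apply: prodr_ile1 => h _; rewrite v0 bary_le1.
(* Each chosen coordinate of [v] is at least the weight, so removing mass [t] from it leaves it
   nonnegative; halving ensures [t < 1]. The point [u] solves [v = t *: vertex c + (1 - t) *: u]. *)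
pose t := weight c v / 2.
have t01 : 0 < t < 1 by rewrite /t; apply/andP; split; lra.
have t1 : 1 - t != 0 by case/andP: t01 => _ ?; rewrite subr_eq0 gt_eqF.
pose u := (1 - t)^-1 *: v + (1 - (1 - t)^-1) *: vertex c.
have vE : v = t *: vertex c + (1 - t) *: u.
  rewrite /u; move: (vertex c) => w.
  rewrite scalerDr !scalerA mulfV // scale1r mulrBr mulr1 mulfV // addrCA.
  rewrite -scalerDl (_ : t + (1 - t - 1) = 0); last by ring.
  by rewrite scale0r addr0.
suff Pu : P u by have [] := ext _ _ _ (semisimplex_vertex cB) Pu t01 vE.
apply/semisimplexE => f; rewrite /u bary_comb bary_vertex //.
have t1_gt0 : 0 < 1 - t by case/andP: t01; rewrite subr_gt0.
rewrite -(pmulr_rge0 _ t1_gt0) mulrDr mulrA mulfV // mul1r mulrA mulrBr mulfV // mulr1.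
case: (boolP (c (block f) == f)) => [/w_le wf|_]; last by rewrite mulr0 addr0.
by rewrite mulr1 /t; have := v0 f; lra.
Qed.

Lemma interior_bary_gt0 f x : interior P x -> 0 < bary f x.
Proof.
move=> Px; have x0 : 0 <= bary f x.
  by move: f; apply/semisimplexE/(interior_subset Px).
rewrite lt_def x0 andbT; apply/negP => /eqP xf0.
have [c cB cf] : exists2 c, c \in choices & c (block f) == f.
  (* Outside the block of [f], [inr j] is a choice available in every block, even an empty one. *)
  exists [ffun j => if j == block f then f else inr j]; last by rewrite ffunE eqxx.
  by apply/choicesP => j; rewrite ffunE; case: eqP => [->|].
(* Moving from [x] straight away from a vertex off the facet [f] leaves [P]. *)
have cvgx : t *: (x - vertex c) + x @[t --> (0 : R)^'+] --> x.
  rewrite -[X in _ --> X]add0r -(scale0r (x - vertex c)).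
  apply: cvgD; last exact: cvg_cst.
  by apply: cvgZr_tmp; exact: cvg_within.
have [t [t0 /semisimplexE/(_ f)]] :
    exists t : R, 0 < t /\ P (t *: (x - vertex c) + x).
  apply: (@filter_ex _ (0 : R)^'+); apply: filterI; last exact: (cvgx _ Px).
  exact: nbhs_right_gt.
have -> : t *: (x - vertex c) + x = (1 + t) *: x + (1 - (1 + t)) *: vertex c.
  move: (vertex c) => v; rewrite opprD addrA subrr add0r scalerBr scalerDl.
  by rewrite scale1r scaleNr addrAC [t *: x + x]addrC.
rewrite bary_comb bary_vertex // cf xf0 mulr0 add0r mulr1 opprD addrA subrr.
by rewrite add0r oppr_ge0 leNgt t0.
Qed.

(** [weight] read off from the vertex as a point: the chosen facets are those whose coordinate is 1
    there. *)
Definition bary_weight x v : R := \prod_(f | bary f v == 1) bary f x.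

Lemma bary_weight_vertex c x : c \in choices -> bary_weight x (vertex c) = weight c x.
Proof.
move=> cB; apply: eq_bigl => f; rewrite bary_vertex //.
by case: (_ == f); rewrite ?eqxx // eq_sym oner_eq0.
Qed.

(** * Wachspress and Gibbs coordinates as product weights *)

Section Vertices.
Variable V : seq 'rV[R]_d.
Hypothesis V_uniq : uniq V.
Hypothesis VE : forall v, v \in V <-> extreme_point P v.

Lemma vertices_choice v : v \in V -> exists2 c, c \in choices & v = vertex c.
Proof. by move=> /VE /extreme_pointE. Qed.

Lemma sum_vertices (F : 'rV[R]_d -> R) :
  \sum_(v <- V) F v = \sum_(c in choices) F (vertex c).
Proof.
rewrite -[RHS]big_enum /= -(big_map vertex xpredT F); apply: perm_big.
apply: uniq_perm => // [|v].
  rewrite map_inj_in_uniq ?enum_uniq // => c c'.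
  by rewrite !mem_enum; apply: vertex_inj.
apply/idP/mapP => [/vertices_choice [c cB ->]|[c]].
  by exists c; rewrite ?mem_enum.
by rewrite mem_enum => cB ->; apply/VE/extreme_vertex.
Qed.

Lemma sum_nth_vertices (F : 'rV[R]_d -> R) :
  \sum_(i < size V) F (nth 0 V i) = \sum_(c in choices) F (vertex c).
Proof. by rewrite -sum_vertices [RHS](big_nth 0) big_mkord. Qed.

Lemma wachspress_semisimplex x v : interior P x -> v \in V ->
  wachspress P V x v = bary_weight x v.
Proof.
move=> Px /vertices_choice [c cB ->].
have x0 f : bary f x != 0 by rewrite gt_eqF // interior_bary_gt0.
rewrite /wachspress sum_vertices bary_weight_vertex //.
under eq_bigr => e eB do rewrite wach_weight_vertex //.
rewrite -mulr_sumr sum_weight mulr1 wach_weight_vertex // mulrC mulrA mulVf ?mul1r //.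
have M0 : \det M != 0 by rewrite -unitfE -unitmxE.
have fact0 : d`!%:R != 0 :> R by rewrite pnatr_eq0 -lt0n fact_gt0.
have prod0 : \prod_f bary f x != 0 by apply/prodf_neq0.
by rewrite !mulf_neq0 ?invr_eq0 ?normr_eq0.
Qed.

Lemma feasible_bary x q f : feasible V x q ->
  \sum_i q 0 i * bary f (nth 0 V i) = bary f x.
Proof. by move=> [_ [q1 <-]]; rewrite bary_sum. Qed.

Lemma gibbs_semisimplex x (i : 'I_(size V)) : P x ->
  gibbs V x i = bary_weight x (nth 0 V i).
Proof.
move=> Px; have x0 f : 0 <= bary f x by move: f; apply/semisimplexE.
pose p : 'rV[R]_(size V) := \row_i bary_weight x (nth 0 V i).
have sum_p (F : 'rV[R]_d -> R) :
    \sum_i p 0 i * F (nth 0 V i) = \sum_(c in choices) weight c x * F (vertex c).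
  under eq_bigr do rewrite mxE.
  rewrite (sum_nth_vertices (fun v => bary_weight x v * F v)).
  by apply: eq_bigr => c cB; rewrite bary_weight_vertex.
have p1 : \sum_i p 0 i = 1.
  under eq_bigr do rewrite -[p 0 _]mulr1.
  rewrite (sum_p (fun=> 1)) -[RHS](sum_weight x).
  by apply: eq_bigr => c _; rewrite mulr1.
have fp : feasible V x p.
  split=> [l|]; first by rewrite mxE prodr_ge0.
  split=> //; apply: bary_inj => f; rewrite bary_sum // sum_p.
  exact: weight_marginal.
(* The logarithm of the product distribution, written as an affine function of the vertex; its mean
   thus depends only on the marginals, which feasibility fixes. *)
pose L (l : 'I_(size V)) := \sum_f bary f (nth 0 V l) * ln (bary f x).
have sumL q : feasible V x q -> \sum_l q 0 l * L l = \sum_f bary f x * ln (bary f x).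
  move=> fq; under eq_bigr do rewrite mulr_sumr.
  rewrite exchange_big /=; apply: eq_bigr => f _.
  rewrite -(feasible_bary f fq) mulr_suml; apply: eq_bigr => l _.
  by rewrite mulrA.
have Vge0 (l : 'I_(size V)) f : 0 <= bary f (nth 0 V l).
  have [c cB ->] := vertices_choice (mem_nth 0 (ltn_ord l)).
  by rewrite bary_vertex ?ler0n.
have maxP : forall q, max_entropy V x q <-> q = p.
  apply: (max_entropy_uniqueP (L := L) fp) => [l|q fq|q fq l].
  - rewrite /L mxE; have [c cB ->] := vertices_choice (mem_nth 0 (ltn_ord l)).
    rewrite bary_weight_vertex // => /prodf_neq0 w0.
    rewrite ln_prod => [|f cf]; last by rewrite lt_def w0 ?x0.
    rewrite big_mkcond; apply: eq_bigr => f _; rewrite bary_vertex //.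
    by case: (_ == f); rewrite ?mul1r ?mul0r.
  - by rewrite !sumL.
  (* A zero weight comes from a facet coordinate that is 0 at [x] and 1 at the vertex; as a mean of
     nonnegative terms equal to 0, it forces [q] to vanish there. *)
  - rewrite mxE => /eqP /prodf_eq0 [f /eqP Vf /eqP xf0].
    have /eqP := feasible_bary f fq; rewrite xf0 psumr_eq0 => [|m _].
      by move=> /allP /(_ l (mem_index_enum _)) /=; rewrite Vf mulr1 => /eqP.
    by apply: mulr_ge0 => //; case: fq.
rewrite /gibbs; set q := xget _ _.
have /maxP -> : max_entropy V x q.
  by apply: (xgetPex 0 (P := [set q | max_entropy V x q])); exists p; apply/maxP.
by rewrite mxE.
Qed.

End Vertices.
End Semisimplex.

Theorem theorem5p5 (R : realType) (d : nat) (P : set 'rV[R]_d)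
    (V : seq 'rV[R]_d) :
  semisimplex P ->
  uniq V ->
  (forall v, v \in V <-> extreme_point P v) ->
  forall x : 'rV[R]_d, P x ->
  forall i : 'I_(size V),
    (interior P x -> wachspress P V x (nth 0 V i) = gibbs V x i) /\
    ((fun y => wachspress P V y (nth 0 V i)) @ within (interior P) (nbhs x)
       --> gibbs V x i).
Proof.
move=> [k [g [M [b [Mu ->]]]]] V_uniq VE x Px i.
have Vi : nth 0 V i \in V by rewrite mem_nth.
rewrite (gibbs_semisimplex Mu V_uniq VE i Px).
split=> [Px0|]; first exact: wachspress_semisimplex.
(* The product formula is continuous on the whole space and agrees with the Wachspress coordinate on
   the interior, so it provides the limit at boundary points too. *)
have : bary_weight g M b y (nth 0 V i) @[y --> nbhs x] -->
    bary_weight g M b x (nth 0 V i).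
  by apply: continuous_prod => f _; apply: continuous_bary.
move=> /(cvg_within_filter (interior [set y *m M + b | y in corner_prod g])).
apply: cvg_trans; apply: near_eq_cvg; apply: filterS (withinT _ _) => y Py.
by rewrite (wachspress_semisimplex Mu V_uniq VE).
Qed.
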